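(* For any fixed integer $d\ge 0$, as $n\to\infty$, $$\#F_n^d\sim 2^{\,n-2d-1}(d+1)^n,$$ that is, $\lim_{n\to\infty}\dfrac{\#F_n^d}{2^{\,n-2d-1}(d+1)^n}=1$, where $F_n^d$ is the set of permutations of $[n]$ with exactly $d$ kinks beyond the initial one (as defined in the context).
   Context: Let $[n]=\{1,\dots,n\}$ and let $S_n$ be the set of permutations of $[n]$, written as words $\pi=\pi_1\pi_2\cdots\pi_n$ with $\pi_i=\pi(i)$. A permutation is viewed as a history on the path with vertices $1,\dots,n$ (with $i$ adjacent to $i+1$), where at time $i$ the vertex $\pi_i$ is flipped. An index $i$ with $2\le i\le n$ is an (extra) kink creation if no vertex adjacent to $\pi_i$ was flipped earlier, i.e. there is no $k<i$ with $\pi_k=\pi_i-1$ or $\pi_k=\pi_i+1$. For $d\ge 0$, $F_n^d$ denotes the set of $\pi\in S_n$ having exactly $d$ such indices $i\in\{2,\dots,n\}$ (the initial flip $i=1$ is not counted). $\#F_n^d$ is its cardinality. *)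

(* Defs.v *)
From mathcomp Require Import all_boot all_fingroup.

Set Implicit Arguments.
Unset Strict Implicit.
Unset Printing Implicit Defensive.

(* Vertices and times are both 'I_n, i.e. shifted from {1, ..., n} to
   {0, ..., n - 1}; the shift preserves adjacency on the path and the order of
   times, and the initial flip is the one at time 0. *)
Definition path_adj (n : nat) (u v : 'I_n) : bool :=
  (u.+1 == v :> nat) || (v.+1 == u :> nat).

Definition extra_kink (n : nat) (s : 'S_n) (i : 'I_n) : bool :=
  (0 < i) && ~~ [exists k : 'I_n, (k < i) && path_adj (s k) (s i)].

Definition F (n d : nat) : {set 'S_n} :=
  [set s : 'S_n | #|[set i : 'I_n | extra_kink s i]| == d].

(* Main.v *)
Require Import Defs.
From mathcomp Require Import all_boot all_order all_algebra all_fingroup.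
From mathcomp Require Import all_classical all_reals all_analysis.
From mathcomp Require Import ring lra zify.
Import Order.TTheory GRing.Theory Num.Theory.
Import numFieldNormedType.Exports.
Local Open Scope classical_set_scope.
Local Open Scope ring_scope.

(** The proof passes from kinks to peaks.  Read through the inverse
    permutation, the vertices creating a kink (the initial one included) are
    the local minima of a labelling of a path by flip times, and deleting the
    last flip removes the maximal label.  Putting a vertex flipped last
    into one of the n + 1 gaps of a path of length n keeps the number of extra
    kinks, or raises it by one: it creates a kink exactly when it separates a
    vertex from its only earlier neighbour.  Counting degrees in the path
    oriented by time shows that a history with d extra kinks has 2 (d + 1)
    neutral gaps, whence ([card_F_rec])
      #F(n+1, d) = 2 (d + 1) #F(n, d) + (n + 1 - 2 d) #F(n, d - 1).

    This recurrence gives the growth rate (2 d + 2)^n of #F(n, d), but leaves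
    the constant in front of it as an infinite sum.  The constant comes from
    the Eulerian numbers
    A(n, j) = sum_i (-1)^i C(n+1, i) (j+1-i)^n.  The normalised numbers
    g(n, d) = 2^(2d+1-n) #F(n, d), whose quotients by (d+1)^n are the ratios
    in the theorem, are the coordinates of the Eulerian polynomial
    sum_j A(n, j) t^j on the polynomials t^d (1+t)^(n-1-2d): this is
    [eulerian_gamma],
      A(n, j) = sum_(e <= j) g(n, e) C(n-1-2e, j-e),
    which holds because both sides satisfy the Eulerian recurrence.

    Now A(n, d) ~ (d+1)^n, since the terms i > 0 of the alternating sum are a
    binomial coefficient of fixed lower index times a smaller exponential.  In
    the expansion of A(n, d) the term e = d is g(n, d) itself, while
    by induction g(n, e) ~ (e+1)^n for e < d, so that the other terms are again
    negligible before (d+1)^n.  Hence g(n, d) ~ (d+1)^n. *)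

Set Implicit Arguments.
Unset Strict Implicit.
Unset Printing Implicit Defensive.

(** * Inserting a vertex that is flipped last *)

Section LastFlip.
Local Open Scope nat_scope.

Lemma ex_lift_max n (P : pred 'I_n.+1) (i : 'I_n) :
  [exists k : 'I_n.+1, (k < lift ord_max i) && P k]
  = [exists k : 'I_n, (k < i) && P (lift ord_max k)].
Proof.
have ltE (k : 'I_n) : (lift ord_max k < lift ord_max i) = (k < i).
  by rewrite /= /bump; lia.
apply/existsP/existsP=> -[k /andP[lt_ki Pk]]; last first.
  by exists (lift ord_max k); rewrite ltE lt_ki.
case: (unliftP ord_max k) lt_ki Pk => [k' ->|-> lt_ki].
  by rewrite ltE => lt Pk; exists k'; rewrite lt.
by move: lt_ki; rewrite /= /bump; have := ltn_ord i; lia.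
Qed.

(** Orient each edge of the path towards its endpoint flipped later.  Then
    [left_earlier s i] and [right_earlier s i] say which of the two edges at the
    vertex flipped at time i point to it; a kink is a source. *)
Definition left_earlier n (s : 'S_n) (i : 'I_n) : bool :=
  [exists k : 'I_n, (k < i) && ((s k).+1 == s i :> nat)].
Definition right_earlier n (s : 'S_n) (i : 'I_n) : bool :=
  [exists k : 'I_n, (k < i) && ((s i).+1 == s k :> nat)].

Lemma extra_kinkE n (s : 'S_n) i :
  extra_kink s i = [&& 0 < i, ~~ left_earlier s i & ~~ right_earlier s i].
Proof.
rewrite /extra_kink -negb_or; congr (_ && ~~ _).
apply/existsP/orP => [[k /andP[lt /orP[]e]]|[]/existsP[k /andP[lt e]]].
- by left; apply/existsP; exists k; rewrite lt e.
- by right; apply/existsP; exists k; rewrite lt e.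
- by exists k; rewrite lt /path_adj e.
- by exists k; rewrite lt /path_adj e orbT.
Qed.

(** In [lift_perm ord_max v s] the vertex v is flipped last and the history of
    the others is s, with a gap opened between v - 1 and v.  The only edge
    lost by the older vertices is the one across that gap. *)
Lemma left_earlier_lift n (s : 'S_n) v i :
  left_earlier (lift_perm ord_max v s) (lift ord_max i) =
  left_earlier s i && (s i != v :> nat).
Proof.
rewrite /left_earlier ex_lift_max.
apply/existsP/andP => [[k]|[/existsP[k /andP[lt e]] ne]].
  rewrite !lift_perm_lift /= => /andP[lt e]; split; last by move: e; rewrite /bump; lia.
  by apply/existsP; exists k; rewrite lt; move: e; rewrite /bump; lia.
by exists k; rewrite !lift_perm_lift lt /=; move: e ne; rewrite /bump; lia.
Qed.

Lemma right_earlier_lift n (s : 'S_n) v i :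
  right_earlier (lift_perm ord_max v s) (lift ord_max i) =
  right_earlier s i && ((s i).+1 != v :> nat).
Proof.
rewrite /right_earlier ex_lift_max.
apply/existsP/andP => [[k]|[/existsP[k /andP[lt e]] ne]].
  rewrite !lift_perm_lift /= => /andP[lt e]; split; last by move: e; rewrite /bump; lia.
  by apply/existsP; exists k; rewrite lt; move: e; rewrite /bump; lia.
by exists k; rewrite !lift_perm_lift lt /=; move: e ne; rewrite /bump; lia.
Qed.

(** A path with at least two vertices has no isolated vertex. *)
Lemma extra_kink_last n (s : 'S_n.+2) : ~~ extra_kink s ord_max.
Proof.
rewrite /extra_kink /= negbK.
suff [w adj_w] : exists w, path_adj w (s ord_max).
  apply/existsP; exists (s^-1%g w); rewrite permKV adj_w andbT.
  have : s^-1%g w != ord_max.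
    by apply: contraTneq adj_w => <-; rewrite permKV /path_adj; lia.
  rewrite -val_eqE /=; have := ltn_ord (s^-1%g w); lia.
case: (posnP (s ord_max)) => [s0|s_gt0].
  by exists (inord 1); rewrite /path_adj inordK // s0.
exists (inord (s ord_max).-1); rewrite /path_adj inordK; first by lia.
by have := ltn_ord (s ord_max); lia.
Qed.

(** The edge crossed by the gap v joins v - 1 to v, and exists when
    0 < v < n; it points to exactly one of its endpoints. *)
Lemma edge_oriented_once n (s : 'S_n) (v : 'I_n.+1) :
  \sum_(i < n) (left_earlier s i && (s i == v :> nat))
  + \sum_(i < n) (right_earlier s i && ((s i).+1 == v :> nat)) = (0 < v < n).
Proof.
case: (boolP (0 < v < n)) => [/andP[v_gt0 v_ltn]|out]; last first.
  rewrite !big1 // => i _; apply/eqP; rewrite eqb0; apply/negP => /andP[/existsP[k /andP[_ e]] e'].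
    by have := ltn_ord (s k); have := ltn_ord (s i); lia.
  by have := ltn_ord (s k); have := ltn_ord (s i); lia.
have u_ltn : v.-1 < n by lia.
pose w := Ordinal v_ltn; pose u := Ordinal u_ltn.
pose i := (s^-1)%g w; pose j := (s^-1)%g u.
have si : s i = w by rewrite permKV.
have sj : s j = u by rewrite permKV.
rewrite (bigD1 i) //= big1 ?addn0 => [|k ne]; last first.
  apply/eqP; rewrite eqb0; apply: contra ne => /andP[_ /eqP e].
  by rewrite -(inj_eq (@perm_inj _ s)) si; apply/eqP/val_inj.
rewrite (bigD1 j) //= big1 ?addn0 => [|k ne]; last first.
  apply/eqP; rewrite eqb0; apply: contra ne => /andP[_ /eqP e].
  by rewrite -(inj_eq (@perm_inj _ s)) sj; apply/eqP/val_inj; rewrite /= -e.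
have -> : left_earlier s i = (j < i).
  apply/existsP/idP => [[k /andP[lt /eqP e]]|lt].
    suff -> : j = k by [].
    by apply: (@perm_inj _ s); apply: val_inj; rewrite sj /=; move: e; rewrite si /=; lia.
  by exists j; rewrite lt si sj /=; lia.
have -> : right_earlier s j = (i < j).
  apply/existsP/idP => [[k /andP[lt /eqP e]]|lt].
    suff -> : i = k by [].
    by apply: (@perm_inj _ s); apply: val_inj; rewrite si; move: e; rewrite sj /=; lia.
  by exists i; rewrite lt si sj /=; lia.
have ne_ij : i != j :> nat.
  apply/eqP => /val_inj e; move: si; rewrite e sj => /(congr1 val) /=; lia.
rewrite si sj /=; lia.
Qed.

Definition kinks n (s : 'S_n) : nat := \sum_(i < n) extra_kink s i.

(** The vertex that becomes a source when the edge across the gap v is cut is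
    the one to which this edge points, provided that no other edge points to it. *)
Definition kinks_opened n (s : 'S_n) (v : 'I_n.+1) : nat :=
  \sum_(i < n) [&& left_earlier s i, ~~ right_earlier s i & s i == v :> nat]
  + \sum_(i < n) [&& right_earlier s i, ~~ left_earlier s i & (s i).+1 == v :> nat].

Lemma left_earlier_gt0 n (s : 'S_n) (i : 'I_n) : left_earlier s i -> 0 < i.
Proof. by case/existsP=> k /andP[lt _]; lia. Qed.
Lemma right_earlier_gt0 n (s : 'S_n) (i : 'I_n) : right_earlier s i -> 0 < i.
Proof. by case/existsP=> k /andP[lt _]; lia. Qed.

Lemma kinks_lift n (s : 'S_n.+1) v :
  kinks (lift_perm ord_max v s) = kinks s + kinks_opened s v.
Proof.
rewrite /kinks /kinks_opened big_ord_recr /= (negbTE (extra_kink_last _)) addn0 -!big_split /=.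
apply: eq_bigr => i _.
have -> : widen_ord (leqnSn n.+1) i = lift ord_max i.
  by apply: val_inj; rewrite /= /bump; have := ltn_ord i; lia.
rewrite !extra_kinkE left_earlier_lift right_earlier_lift.
have -> : (0 < lift ord_max i) = (0 < i) by rewrite /= /bump; have := ltn_ord i; lia.
move: (@left_earlier_gt0 _ s i) (@right_earlier_gt0 _ s i).
case: (0 < i); case: left_earlier; case: right_earlier => //= hL hR;
  try (by have := hL isT); try (by have := hR isT); lia.
Qed.

Lemma kinks_opened_le1 n (s : 'S_n) v : kinks_opened s v <= 1.
Proof.
apply: (@leq_trans (0 < v < n)); last exact: leq_b1.
rewrite -(edge_oriented_once s); apply: leq_add; apply: leq_sum => i _;
  by case: left_earlier; case: right_earlier.
Qed.

Lemma sum_eq_ord n k (b : bool) : k < n -> \sum_(v < n) (b && (k == v :> nat)) = b.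
Proof.
move=> lt_kn; rewrite (bigD1 (Ordinal lt_kn)) //= eqxx andbT big1 ?addn0 // => v.
by rewrite -val_eqE /= eq_sym => /negbTE ->; rewrite andbF.
Qed.

(** With N0, N1, N2 the numbers of vertices of indegree 0, 1, 2, there are
    N0 + N1 + N2 = n + 1 vertices and N1 + 2 N2 = n edges, so that
    N1 + 2 N0 = n + 2.  Each vertex of indegree 1 accounts for one gap that
    opens a kink, and N0 counts the initial flip besides the extra kinks. *)
Lemma sum_kinks_opened n (s : 'S_n.+1) : \sum_(v < n.+2) kinks_opened s v + (kinks s).+1.*2 = n.+2.
Proof.
(* The number of edges, as the sum of the indegrees *)
have load : \sum_(i < n.+1) (left_earlier s i + right_earlier s i) = n.
  have : \sum_(v < n.+2) (0 < v < n.+1) = n.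
    rewrite big_ord_recl big_ord_recr /= /bump /= add0n.
    rewrite ltnn addn0 (eq_bigr (fun=> 1)) => [|i _]; first by rewrite sum1_card card_ord.
    by rewrite /bump; have := ltn_ord i; lia.
  under eq_bigr => v _ do rewrite -(edge_oriented_once s v).
  rewrite big_split /= exchange_big /= [X in _ + X]exchange_big /= -big_split /= => e.
  rewrite -[RHS]e; apply: eq_bigr => i _.
  by rewrite !sum_eq_ord // ltnS; have := ltn_ord (s i); lia.
have -> : \sum_(v < n.+2) kinks_opened s v
   = \sum_(i < n.+1) ((left_earlier s i && ~~ right_earlier s i)
                        + (right_earlier s i && ~~ left_earlier s i)).
  rewrite [LHS]big_split /= exchange_big /= [X in _ + X]exchange_big /= -big_split /=.
  apply: eq_bigr => i _; under eq_bigr do rewrite andbA.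
  under [X in _ + X]eq_bigr do rewrite andbA.
  by rewrite !sum_eq_ord // ltnS; have := ltn_ord (s i); lia.
have -> : (kinks s).+1 = \sum_(i < n.+1) (~~ left_earlier s i && ~~ right_earlier s i).
  rewrite /kinks !big_ord_recl !extra_kinkE /= add0n -add1n; congr (_ + _).
    case: left_earlier (@left_earlier_gt0 _ s ord0) => [/(_ isT)//|_].
    by case: right_earlier (@right_earlier_gt0 _ s ord0) => [/(_ isT)|].
  by apply: eq_bigr => i _; rewrite extra_kinkE.
(* Each vertex satisfies 2 [indegree 0] + [indegree 1] + indegree = 2 *)
have : \sum_(i < n.+1) 2 = 2 * n.+1 by rewrite sum_nat_const card_ord mulnC.
have -> : \sum_(i < n.+1) 2 = \sum_(i < n.+1)
   (((left_earlier s i && ~~ right_earlier s i) + (right_earlier s i && ~~ left_earlier s i))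
  + (~~ left_earlier s i && ~~ right_earlier s i)
  + (~~ left_earlier s i && ~~ right_earlier s i)
  + (left_earlier s i + right_earlier s i)).
  by apply: eq_bigr => i _; case: left_earlier; case: right_earlier.
rewrite big_split /= load 2!big_split /=; lia.
Qed.

Lemma lift_perm_bij n : bijective (fun p : 'I_n.+1 * 'S_n => lift_perm ord_max p.1 p.2).
Proof.
apply: inj_card_bij => [[v s] [w t] /= e|]; last first.
  by rewrite card_prod !card_Sn card_ord factS.
have e1 : v = w by rewrite -(lift_perm_id ord_max v s) e lift_perm_id.
congr (_, _); first exact: e1.
apply/permP => i; apply: (@lift_inj _ v).
by rewrite -(lift_perm_lift ord_max) e -e1 lift_perm_lift.
Qed.

Lemma card_F n d : #|F n d| = \sum_(s : 'S_n) (kinks s == d).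
Proof.
rewrite /F -sum1dep_card big_mkcond; apply: eq_bigr => s _.
have -> : #|[set i | extra_kink s i]%SET| = kinks s by rewrite -sum1dep_card big_mkcond.
by case: eqP.
Qed.

(** By [sum_kinks_opened], a history of n + 1 vertices with d extra kinks has
    2 (d + 1) gaps that keep d, and one with e extra kinks has n - 2 e gaps
    that raise e.  The truncated subtraction is harmless: no history has e
    extra kinks when n < 2 e. *)
Lemma card_F_rec n d : #|F n.+2 d| =
  d.+1.*2 * #|F n.+1 d| + (if d is e.+1 then (n - e.*2) * #|F n.+1 e| else 0).
Proof.
rewrite card_F (reindex _ (onW_bij _ (@lift_perm_bij n.+1))) /=.
rewrite -(pair_bigA _ (fun v s => (kinks (lift_perm ord_max v s) == d) : nat)) exchange_big /=.
transitivity (\sum_(s : 'S_n.+1) (d.+1.*2 * (kinks s == d) +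
   (if d is e.+1 then (n - e.*2) * (kinks s == e) else 0))); last first.
  rewrite big_split /= !card_F !big_distrr /=; congr (_ + _).
  by case: d => [|e]; [rewrite big1|rewrite card_F big_distrr].
apply: eq_bigr => s _.
have tot := sum_kinks_opened s.
transitivity ((kinks s == d) * d.+1.*2 + ((kinks s).+1 == d) * \sum_(v < n.+2) kinks_opened s v).
  transitivity (\sum_(v < n.+2) ((kinks s == d) * (1 - kinks_opened s v)
                                 + ((kinks s).+1 == d) * kinks_opened s v)).
    apply: eq_bigr => v _; rewrite kinks_lift.
    by case: (kinks_opened s v) (kinks_opened_le1 s v) => [|[|//]] _;
      rewrite ?addn0 ?addn1 ?muln1 ?muln0 ?addn0.
  rewrite big_split /= -!big_distrr /=; congr (_ + _).
  case: eqP => [<-|//]; rewrite !mul1n.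
  suff : \sum_(v < n.+2) (1 - kinks_opened s v) + \sum_(v < n.+2) kinks_opened s v = n.+2.
    by move=> h; apply: (@addIn (\sum_(v < n.+2) kinks_opened s v)); rewrite h addnC tot.
  rewrite -big_split /= (eq_bigr (fun=> 1)) ?sum1_card ?card_ord // => v _.
  by rewrite subnK // kinks_opened_le1.
rewrite mulnC; congr (_ + _); case: d => [|e] //.
rewrite eqSS mulnC; case: eqP => [<-|]; last by rewrite !muln0.
by rewrite !muln1; lia.
Qed.

(** Between two kinks, the initial one included, there is a vertex of
    indegree 2, so that d extra kinks require 2 d + 1 vertices. *)
Lemma card_F_large n d : n <= d.*2 -> 0 < n -> #|F n d| = 0.
Proof.
case: n => // n le _; rewrite card_F big1 // => s _; apply/eqP; rewrite eqb0.
by apply/eqP => k_eq; have := sum_kinks_opened s; rewrite k_eq; lia.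
Qed.

Lemma card_F1 d : #|F 1 d| = (d == 0).
Proof.
case: d => [|d]; last by rewrite card_F_large.
rewrite card_F (eq_bigr (fun=> 1)) ?sum1_card ?card_Sn // => s _.
by have := sum_kinks_opened s; case: eqP => //; lia.
Qed.

End LastFlip.

(** * Eulerian numbers and their gamma expansion *)

Lemma mul_bin_leftR (A : pzRingType) n i :
  i.+1%:R * 'C(n, i.+1)%:R = (n%:R - i%:R) * 'C(n, i)%:R :> A.
Proof.
rewrite -natrM mul_bin_left; case: (leqP i n) => [le_in|lt_ni].
  by rewrite natrM natrB.
by rewrite bin_small // muln0 mulr0.
Qed.

Section Eulerian.
Variable R : realFieldType.

(** The number of permutations of n elements with j descents, for n > 0. *)
Definition eulerian n j : R :=
  \sum_(i < j.+1) (-1) ^+ i * 'C(n.+1, i)%:R * (j.+1 - i)%N%:R ^+ n.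

(** After the common terms are collected, Pascal's rule reduces the
    recurrence to (i + 1) C(n+1, i+1) = (n + 1 - i) C(n+1, i). *)
Lemma eulerian_rec n j :
  eulerian n.+1 j.+1 = j.+2%:R * eulerian n j.+1 + (n%:R - j%:R) * eulerian n j.
Proof.
rewrite /eulerian [LHS]big_ord_recl [in RHS]big_ord_recl /= !bin0 !subn0.
rewrite mulrDr -addrA !mulr_sumr -big_split /=.
congr (_ + _); first by rewrite exprS; ring.
apply: eq_bigr => i _; rewrite /bump /= !add1n subSS exprS binS natrD.
have le_ij : (i <= j)%N by rewrite -ltnS.
have := mul_bin_leftR R n.+1 i; rewrite subSn // -!natr1 natrB // exprS.
set b := 'C(_, _)%:R; set c := 'C(_, _)%:R; set x := _ ^+ n => bc.
transitivity (- (-1) ^+ i * x * ((j%:R + 1 - i%:R) * b + (j%:R + 2 - (i%:R + 1)) * c)); first by ring.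
transitivity (- (-1) ^+ i * x * ((j%:R + 2) * b - (n%:R - j%:R) * c)); last by ring.
congr (_ * _); lra.
Qed.

Lemma eulerian_n0 n : eulerian n 0 = 1.
Proof. by rewrite /eulerian big_ord1 bin0 subn0 expr1n !mulr1. Qed.

Lemma eulerian_1n j : eulerian 1 j.+1 = 0.
Proof.
have eul0 k : eulerian 0 k = (k == 0)%N%:R.
  rewrite /eulerian; case: k => [|k]; first by rewrite big_ord1 bin0 !mulr1.
  rewrite 2!big_ord_recl big1 => [|i _]; last by rewrite /= bin_small // mulr0 mul0r.
  by rewrite /= !bin0 !bin1; ring.
by rewrite eulerian_rec !eul0 mulr0 add0r; case: j => [|j]; rewrite ?subrr ?mul0r ?mulr0.
Qed.

(** The coefficients of the Eulerian polynomial of order n in the basis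
    t^d (1+t)^(n-1-2d), known as its gamma vector; see [eulerian_gamma]. *)
Definition gamma_F n d : R := #|F n d|%:R * 2 ^+ d.*2.+1 / 2 ^+ n.

Lemma gamma_F1 d : gamma_F 1 d = (d == 0)%N%:R.
Proof. by rewrite /gamma_F card_F1; case: d => [|d]; rewrite ?mul0r // mul1r divff. Qed.

Lemma gamma_F0 n : gamma_F n.+1 0 = 1.
Proof.
elim: n => [|n IHn]; first by rewrite gamma_F1.
rewrite -[RHS]IHn /gamma_F card_F_rec addn0 natrM (exprS _ n.+1) (_ : 1.*2 = 2)%N //.
by field; rewrite expf_neq0 // pnatr_eq0.
Qed.

Lemma gamma_F_large n d : (0 < n <= d.*2)%N -> gamma_F n d = 0.
Proof. by case/andP=> n0 le; rewrite /gamma_F card_F_large // !mul0r. Qed.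

Lemma gamma_F_rec n d : gamma_F n.+2 d.+1 =
  d.+2%:R * gamma_F n.+1 d.+1 + 2 * (n%:R - d.*2%:R) * gamma_F n.+1 d.
Proof.
have [le_dn|lt_nd] := leqP d.*2 n; last by rewrite !gamma_F_large ?mulr0 ?addr0 //=; lia.
rewrite /gamma_F card_F_rec natrD !natrM -natrB //.
rewrite -[d.+2.*2]mul2n natrM (exprS _ n.+1) doubleS !exprS.
by field.
Qed.

(** Both sides satisfy the recurrence [eulerian_rec].  For the right-hand
    side it holds termwise in the gamma numbers: with m = n - 2 e and
    i = j - e it amounts to the two evaluations
    (i + 1) C(m, i+1) = m C(m-1, i) = (m - i) C(m, i).
    Terms with 2 e > n, where the truncated m is meaningless, vanish with
    their gamma number. *)
Lemma eulerian_gamma n j :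
  eulerian n.+1 j = \sum_(e < j.+1) gamma_F n.+1 e * 'C(n - e.*2, j - e)%:R.
Proof.
elim: n j => [|n IHn] j.
  rewrite big_ord_recl gamma_F1 mul1r big1 ?addr0 => [|e _]; last by rewrite gamma_F1 mul0r.
  by case: j => [|j]; rewrite ?eulerian_n0 ?eulerian_1n ?bin0 ?bin0n //.
case: j => [|j]; first by rewrite eulerian_n0 big_ord1 gamma_F0 bin0 mulr1.
rewrite eulerian_rec !IHn [in RHS]big_ord_recl gamma_F0 /= mul1r !subn0.
under [in RHS]eq_bigr => e _ do rewrite /bump /= add1n gamma_F_rec mulrDl.
rewrite big_split /= addrA.
(* Reindexing the first half of the recurrence puts the term e = 0 back *)
have -> : 'C(n.+1, j.+1)%:R + \sum_(e < j.+1) 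
      e.+2%:R * gamma_F n.+1 e.+1 * 'C(n.+1 - e.+1.*2, j.+1 - e.+1)%:R
   = \sum_(e < j.+2) e.+1%:R * gamma_F n.+1 e * 'C(n.+1 - e.*2, j.+1 - e)%:R.
  by rewrite [RHS]big_ord_recl gamma_F0 /= !mul1r subn0.
rewrite [in LHS]big_ord_recr [in RHS]big_ord_recr /= !subnn !bin0 !mulr1 mulrDr.
rewrite [LHS]addrAC [RHS]addrAC; congr (_ + _).
rewrite !mulr_sumr -!big_split /=; apply: eq_bigr => e _.
have [le_en|lt_ne] := leqP e.*2 n; last by rewrite !gamma_F_large ?(mulr0, mul0r, addr0) //=; lia.
have le_ej : (e <= j)%N by rewrite -ltnS.
rewrite doubleS !subSS subnS (subSn le_en) (subSn le_ej) binS natrD.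
have := mul_bin_diag (n - e.*2) (j - e).
have := mul_bin_leftR R (n - e.*2) (j - e).
move=> bl /(congr1 (fun k => k%:R : R)); rewrite !natrM; move: bl.
rewrite -!natr1 !natrB // -mul2n natrM add0r.
set b := 'C(_, (j - e).+1)%:R; set c := 'C(n - _, _)%:R; set x := 'C(_.-1, _)%:R.
move=> bc xb.
transitivity (gamma_F n.+1 e * ((j%:R + 2) * b + (n%:R + 1 - j%:R) * c)); first by ring.
transitivity (gamma_F n.+1 e * ((e%:R + 1) * (b + c) + 2 * (n%:R - 2 * e%:R) * x)); last by ring.
by congr (_ * _); lra.
Qed.

End Eulerian.

(** * Asymptotics *)

Lemma bin_le_expr (A : numDomainType) (x : A) n k : 0 < x -> 'C(n, k)%:R * x ^+ k <= (1 + x) ^+ n.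
Proof.
move=> x0; have [le_kn|lt_nk] := leqP k n; last first.
  by rewrite bin_small // mul0r exprn_ge0 // addr_ge0 // ltW.
have lt_k : (k < n.+1)%N by [].
rewrite exprDn (bigD1 (Ordinal lt_k)) //= expr1n mul1r mulr_natl lerDl.
by apply: sumr_ge0 => i _; rewrite expr1n mul1r mulrn_wge0 // exprn_ge0 // ltW.
Qed.

Section Asymptotics.
Variable R : realType.

(** The bound C(n, k) <= (1 + x)^n / x^k turns the binomial coefficient into
    an exponential whose base is as close to 1 as needed. *)
Lemma bin_geometric_cvg0 (q : R) k : 0 <= q < 1 ->
  'C(n, k)%:R * q ^+ n @[n --> \oo] --> 0.
Proof.
(* With this x, (1 + x) q = 1 - (1 - q)^2 < 1 *)
case/andP=> q0 q1; set x := 1 - q; have x0 : 0 < x by rewrite subr_gt0.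
have dom_lt1 : `|(1 + x) * q| < 1.
  by rewrite ger0_norm ?mulr_ge0 /x //; nra.
apply: (@squeeze_cvgr _ _ _ _ (cst 0) (geometric (x ^- k) ((1 + x) * q))).
- near=> n; rewrite /= mulr_ge0 ?exprn_ge0 ?ler0n //=.
  rewrite exprMn mulrA ler_wpM2r ?exprn_ge0 // mulrC ler_pdivlMr ?exprn_gt0 //.
  exact: bin_le_expr.
- exact: cvg_cst.
- exact: cvg_geometric.
Unshelve. all: by end_near. Qed.

Lemma cvg_sum0 m (f : 'I_m -> nat -> R) :
  (forall i, f i n @[n --> \oo] --> 0) -> \sum_(i < m) f i n @[n --> \oo] --> 0.
Proof.
move=> f0; suff : \sum_(i < m) f i n @[n --> \oo] --> \sum_(i < m) (0 : R).
  by rewrite [X in _ --> X]big1.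
exact: (cvg_big add_continuous).
Qed.

Lemma ratio_itv a b : (a < b)%N -> 0 <= (a%:R / b%:R : R) < 1.
Proof.
move=> lt_ab; have b0 : 0 < b%:R :> R by rewrite ltr0n; lia.
by rewrite divr_ge0 ?ler0n //= ltr_pdivrMr // mul1r ltr_nat.
Qed.

(** The term i = 0 is (d + 1)^n.  The others are negligible, as the base of
    their power is smaller. *)
Lemma eulerian_cvg d : eulerian R n d / d.+1%:R ^+ n @[n --> \oo] --> (1 : R).
Proof.
have E n : eulerian R n d / d.+1%:R ^+ n = 1 + \sum_(i < d)
    (-1) ^+ i.+1 * ('C(n, i.+1)%:R + 'C(n, i)%:R) * ((d - i)%N%:R / d.+1%:R) ^+ n.
  rewrite /eulerian big_ord_recl bin0 subn0 !mul1r mulrDl divff; last first.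
    by rewrite expf_neq0 // pnatr_eq0.
  rewrite mulr_suml; congr (_ + _); apply: eq_bigr => i _.
  by rewrite lift0 binS natrD subSS expr_div_n mulrA.
rewrite (funext E) -[X in _ --> X]addr0; apply: cvgD; first exact: cvg_cst.
apply: (cvg_sum0 (f := fun (i : 'I_d) n => (-1) ^+ i.+1 * ('C(n, i.+1)%:R + 'C(n, i)%:R)
   * ((d - i)%N%:R / d.+1%:R) ^+ n)) => i.
have q01 : 0 <= ((d - i)%N%:R / d.+1%:R : R) < 1 by apply: ratio_itv; lia.
rewrite (funext (fun n => esym (mulrA _ _ _))) -[X in _ --> X](mulr0 ((-1) ^+ i.+1)).
apply: cvgMl_tmp.
rewrite (funext (fun n => mulrDl _ _ _)).
by rewrite -[X in _ --> X]addr0; apply: cvgD; exact: bin_geometric_cvg0.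
Qed.

(** In [eulerian_gamma] at j = d the last term is the gamma number itself, and
    the terms e < d are of order n^(d-e) (e+1)^n by induction, hence negligible. *)
Lemma gamma_F_cvg d : gamma_F R n d / d.+1%:R ^+ n @[n --> \oo] --> (1 : R).
Proof.
elim/ltn_ind: d => d IHd.
have shiftS (u : nat -> R) (l : R) : u @ \oo --> l -> u n.+1 @[n --> \oo] --> l.
  by rewrite -cvg_shiftS.
suff : gamma_F R n.+1 d / d.+1%:R ^+ n.+1 @[n --> \oo] --> (1 : R).
  by rewrite (cvg_shiftS (fun n => gamma_F R n d / d.+1%:R ^+ n)).
(* Indices start at n + 1 because the expansion needs a nonempty path *)
have gammaE n : gamma_F R n.+1 d / d.+1%:R ^+ n.+1 = eulerian R n.+1 d / d.+1%:R ^+ n.+1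
  - \sum_(e < d) gamma_F R n.+1 e / e.+1%:R ^+ n.+1
     * ('C(n - e.*2, d - e)%:R * (e.+1%:R / d.+1%:R) ^+ n.+1).
  rewrite eulerian_gamma big_ord_recr /= subnn bin0 mulr1 mulrDl mulr_suml.
  rewrite [X in X + _ - _](eq_bigr (fun e : 'I_d => gamma_F R n.+1 e / e.+1%:R ^+ n.+1
     * ('C(n - e.*2, d - e)%:R * (e.+1%:R / d.+1%:R) ^+ n.+1))) => [|e _].
    by rewrite addrAC subrr add0r.
  rewrite expr_div_n; field.
  by rewrite !expf_neq0 // ?pnatr_eq0 // nat1r pnatr_eq0.
rewrite (funext gammaE) -[X in _ --> X]subr0; apply: cvgB.
  exact/(shiftS (fun n => _ n d / _ ^+ n))/eulerian_cvg.
apply: (cvg_sum0 (f := fun (e : 'I_d) n => gamma_F R n.+1 e / e.+1%:R ^+ n.+1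
     * ('C(n - e.*2, d - e)%:R * (e.+1%:R / d.+1%:R) ^+ n.+1))) => e.
rewrite -[X in _ --> X](mulr0 1); apply: cvgM.
  exact: (shiftS (fun n => gamma_F R n e / e.+1%:R ^+ n) _ (IHd e (ltn_ord e))).
have q01 : 0 <= (e.+1%:R / d.+1%:R : R) < 1 by apply: ratio_itv; rewrite ltnS.
apply: (@squeeze_cvgr _ _ _ _ (cst 0) (fun n => 'C(n.+1, d - e)%:R * (e.+1%:R / d.+1%:R) ^+ n.+1)).
- near=> n; case/andP: q01 => q0 _.
  rewrite /= mulr_ge0 ?exprn_ge0 ?ler0n //= ler_wpM2r ?exprn_ge0 // ler_nat.
  by apply: leq_bin2l; lia.
- exact: cvg_cst.
- exact: (shiftS _ _ (bin_geometric_cvg0 (d - e) q01)).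
Unshelve. all: by end_near. Qed.

End Asymptotics.

Theorem theorem5 (R : realType) (d : nat) :
  (fun n : nat =>
     #|F n d|%:R / ((2 : R) ^ (n%:Z - 2 * d%:Z - 1) * (d%:R + 1) ^+ n))
    @ \oo --> (1 : R).
Proof.
have -> : (fun n => #|F n d|%:R / ((2 : R) ^ (n%:Z - 2 * d%:Z - 1) * (d%:R + 1) ^+ n))
  = (fun n => gamma_F R n d / d.+1%:R ^+ n); last exact: gamma_F_cvg.
apply/funext => n; rewrite natr1 /gamma_F.
have -> : (n%:Z - 2 * d%:Z - 1 = n%:Z - d.*2.+1%:Z)%R by lia.
rewrite expfzDr ?pnatr_eq0 // -invr_expz -!exprnP.
by field; rewrite ?expf_neq0 // ?pnatr_eq0 // nat1r pnatr_eq0.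
Qed.
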